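(* Let $s\ge 2$ be an integer with prime decomposition $s=p_1^{e_1}\cdots p_d^{e_d}$ (distinct primes $p_i$, exponents $e_i\ge 1$). Then the semigroup $\langle \mu_{p_1},\dots,\mu_{p_d},\mu_0,\mu_1\rangle\subset CAT(\Lambda_s^{\mathbb N})$ is maximal commutative if and only if $s$ is not a power of a prime.
   Context: $\mathbb N$ includes $0$. $\Lambda_s=\{0,1,\dots,s-1\}$ is the symbol set (discrete topology), and $\Lambda_s^{\mathbb N}$ is the space of one-sided sequences $a=a_0a_1a_2\dots$ with the product topology. $\sigma$ is the left shift, $\sigma(a)_k=a_{k+1}$. $CAT(\Lambda_s^{\mathbb N})$ is the semigroup (under composition) of all continuous maps $\tau:\Lambda_s^{\mathbb N}\to\Lambda_s^{\mathbb N}$ with $\tau\sigma=\sigma\tau$. For a prime $p$ dividing $s$, $\mu_p\in CAT(\Lambda_s^{\mathbb N})$ is defined by $\mu_p(a)_k=\left(p\,a_k+\left\lfloor \frac{p\,a_{k+1}}{s}\right\rfloor\right) \bmod s$. Also $\mu_1$ is the identity map, $\mu_1(a)_k=a_k$, and $\mu_0$ is the zero map, $\mu_0(a)_k=0$ for all $k$. $\langle \tau_1,\dots,\tau_n\rangle$ denotes the semigroup generated by $\tau_1,\dots,\tau_n$ under composition. A semigroup $\Sigma\subset CAT(\Lambda_s^{\mathbb N})$ is maximal commutative (MC) if (1) $\Sigma$ is commutative, and (2) every $\mu\in CAT(\Lambda_s^{\mathbb N})$ with $\mu\tau=\tau\mu$ for all $\tau\in\Sigma$ belongs to $\Sigma$.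 *)

(* Defs.v *)
From mathcomp Require Import all_boot.
From mathcomp Require Import all_classical all_reals all_analysis.

Set Implicit Arguments.
Unset Strict Implicit.
Unset Printing Implicit Defensive.

Local Open Scope classical_set_scope.

Definition seqspace (s : nat) : topologicalType :=
  prod_topology (fun _ : nat => discrete_topology 'I_s).

Definition shift s (a : seqspace s) : seqspace s := fun k => a k.+1.

Definition CAT s : set (seqspace s -> seqspace s) :=
  [set tau | continuous tau /\ tau \o @shift s = @shift s \o tau].

(* The symbol [i] only serves to witness that [s] is positive. *)
Definition symb_mod s (i : 'I_s) (m : nat) : 'I_s :=
  Ordinal (ltn_pmod m (leq_ltn_trans (leq0n i) (ltn_ord i))).

(* [p * b %/ s] parses as [(p * b) %/ s], the floor of pb/s. *)
Definition mu_ (s p : nat) (a : seqspace s) : seqspace s :=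
  fun k => symb_mod (a k) (p * (a k : 'I_s) + p * (a k.+1 : 'I_s) %/ s).

Definition mu_one (s : nat) : seqspace s -> seqspace s := fun a k => a k.

Definition mu_zero (s : nat) : seqspace s -> seqspace s :=
  fun a k => Ordinal (leq_ltn_trans (leq0n (a k : 'I_s)) (ltn_ord (a k))).

Arguments CAT : clear implicits.
Arguments mu_ : clear implicits.
Arguments mu_one : clear implicits.
Arguments mu_zero : clear implicits.

Definition comp_closed s (S : set (seqspace s -> seqspace s)) : Prop :=
  forall tau tau', S tau -> S tau' -> S (tau \o tau').

Definition generated s (G : set (seqspace s -> seqspace s)) :
    set (seqspace s -> seqspace s) :=
  smallest (@comp_closed s) G.

Definition maximal_commutative s (S : set (seqspace s -> seqspace s)) : Prop :=
  [/\ S `<=` CAT s,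
      comp_closed S,
      (forall tau tau', S tau -> S tau' -> tau \o tau' = tau' \o tau)
    & (forall mu, CAT s mu -> (forall tau, S tau -> mu \o tau = tau \o mu) ->
        S mu)].

Definition prime_power (s : nat) : Prop :=
  exists q k : nat, [/\ prime q, 0 < k & s = q ^ k].

(* Main.v *)
Require Import Defs.
From mathcomp Require Import all_boot.
From mathcomp Require Import all_classical all_reals all_analysis.
From mathcomp Require Import zify.

(* [mu_p] is multiplication by [p] on base-[s] expansions, so every element of
   the semigroup multiplies by some [n].  Finite sequences are dense, hence a
   continuous map is determined by its multiplier; this gives commutativity.

   Suppose [tau] commutes with the semigroup.  It fixes [0], so it sends
   [x / s^L] to [T x / s^L] for a map [T] on naturals, independent of [L], that
   commutes with multiplication by every prime dividing [s].  For distinct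
   primes [p], [q] dividing [s] the ratios [p^i / q^j] are dense, so for each
   [A] some [A p^i / q^j] tends to [1] from above; continuity of [tau] at
   [1 / s^L] then forces [T A = T 1 * A].  A prime factor [l] of [T 1] not
   dividing [s] would make [tau] discontinuous at [1 / l], where the product
   jumps across an integer.  So [T 1] is zero or a product of primes dividing
   [s].

   If [s = q^e], then [mu_q] is the shift on base-[q] expansions, and any
   sliding block code on the latter commutes with it.  We use one that kills
   the constant sequence [s - 1], which all powers of [mu_q] fix. *)

Local Open Scope classical_set_scope.

(** * Topology of the sequence space *)

Definition cylinder {s} (a : seqspace s) n : set (seqspace s) :=
  [set b | forall i, i < n -> b i = a i].

Lemma nbhs_seqspaceP {s} (a : seqspace s) (U : set (seqspace s)) :
  nbhs a U <-> exists n, cylinder a n `<=` U.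
Proof.
split=> [aU|[n nU]].
  pose F := filter_from [set: nat] (cylinder a).
  have FF : Filter F.
    apply: filter_from_filter; first by exists 0.
    move=> i j _ _; exists (maxn i j) => // b ab; split=> k lt_k;
      by apply: ab; lia.
  suff /(_ U aU) [n _ nU] : F --> a by exists n.
  (* The product topology is a supremum of initial topologies, so it suffices to treat one
     coordinate [i]; a cylinder of length [i.+1] fixes it. *)
  apply/cvg_sup => i V /= [B [[C oC <-] aC] BV].
  exists i.+1 => // b ab; apply: BV; rewrite /preimage/=.
  by move: aC; rewrite /preimage/= /proj ab.
apply: (@filterS _ (nbhs a) _ _ _ nU).
elim: n {nU} => [|n IHn]; first by apply: filterS filterT.
have an : nbhs a (proj n @^-1` [set a n]).
  have := @proj_continuous nat (fun=> discrete_topology (ordinal s)) n a.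
  by apply; exact: discrete_set1.
apply: filterS (filterI IHn an) => b /= [ab bn] i.
by rewrite ltnS leq_eqVlt => /orP[/eqP->|/ab].
Qed.

Lemma continuous_seqspaceP {s} (tau : seqspace s -> seqspace s) :
  continuous tau <->
  forall a m, exists n, forall b, cylinder a n b -> cylinder (tau a) m (tau b).
Proof.
split=> [ctau a m|ctau a U /nbhs_seqspaceP[m mU]].
  have /ctau/nbhs_seqspaceP[n nU] : nbhs (tau a) (cylinder (tau a) m).
    by apply/nbhs_seqspaceP; exists m.
  by exists n => b /nU.
have [n nm] := ctau a m; rewrite nbhs_simpl; apply/nbhs_seqspaceP.
by exists n => b /nm /mU.
Qed.

(** * Ratios of powers of two primes *)

(** Bernoulli's inequality [(1 + 1/x)^N >= 1 + N/x], cleared of denominators. *)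
Lemma leq_mulexpS x N : x ^ N * (x + N) <= x * x.+1 ^ N.
Proof.
elim: N => [|N IHN]; first by rewrite !expn0 addn0 mul1n muln1.
have := leq_mul (leqnn x.+1) IHN; rewrite !expnS; nia.
Qed.

Lemma ltn_exp_dominate c x y : 0 < x -> x < y -> exists N, c * x ^ N < y ^ N.
Proof.
(* By Bernoulli, [(y/x)^(c*x) >= (1 + 1/x)^(c*x) >= 1 + c]. *)
move=> x0 xy; exists (c * x).
have le1 := leq_mulexpS x (c * x).
have le2 : x.+1 ^ (c * x) <= y ^ (c * x).
  by case: (c * x) => [|N] //; rewrite leq_exp2r.
have : 0 < x ^ (c * x) by rewrite expn_gt0 x0.
move: le1 le2; set X := x ^ _; set X1 := x.+1 ^ _; set Y := y ^ _.
rewrite (_ : X * (x + c * x) = x * (X * c.+1)) ?leq_pmul2l //; nia.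
Qed.

Lemma ltn_mulS_mono n B a c :
  0 < a -> n <= B -> B * c < B.+1 * a -> n * c < n.+1 * a.
Proof.
move=> a0 nB; have [ca|/ltnW ac] := leqP c a; first by nia.
by rewrite -(subnKC ac) !mulnDr !mulSn; have := leq_mul nB (leqnn (c - a)); lia.
Qed.

Lemma prime_powers_close n p q : prime p -> prime q -> p != q -> 0 < n ->
  exists a c, [/\ 0 < a, n * q ^ c < n.+1 * p ^ a & n * p ^ a < n.+1 * q ^ c].
Proof.
move=> pp pq npq n0.
have [p0 q0] := (prime_gt0 pp, prime_gt0 pq).
have [p1 q1] := (prime_gt1 pp, prime_gt1 pq).
(* Pigeonhole: [p ^ i / q ^ j i] lies in [1, q[, which is cut into pieces of
   length [1 / n]. *)
pose j i := trunc_log q (p ^ i).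
have jP i : q ^ j i <= p ^ i < q * q ^ j i.
  by rewrite -expnS; apply: trunc_log_bounds; rewrite // expn_gt0 p0.
pose b i := n * p ^ i %/ q ^ j i.
have bP i :
  [/\ n <= b i, b i * q ^ j i <= n * p ^ i & n * p ^ i < (b i).+1 * q ^ j i].
  have qj0 : 0 < q ^ j i by rewrite expn_gt0 q0.
  have /andP[le1 lt1] := jP i; split.
  - by rewrite leq_divRL // leq_mul.
  - exact: leq_divM.
  - by rewrite -ltn_divLR.
have b_lt i : b i < n * q.
  have /andP[_ lt1] := jP i.
  by rewrite ltn_divLR ?expn_gt0 ?q0 // -mulnA ltn_pmul2l.
pose f (i : 'I_(n * q).+1) : 'I_(n * q) := Ordinal (b_lt i).
have /injectivePn[i1 [i2 ne12 f12]] : ~~ injectiveb f.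
  by apply/negP => /injectiveP/leq_card; rewrite !card_ord ltnn.
wlog lt12 : i1 i2 ne12 f12 / i1 < i2.
  move=> wl; have [//|//|/val_inj eq12] := ltngtP i1 i2.
  - exact: wl.
  - by move=> lt21; apply: (wl i2 i1) => //; rewrite eq_sym.
  - by rewrite eq12 eqxx in ne12.
have {f12} b12 : b i1 = b i2 by case: f12.
have [nb1 le1 gt1] := bP i1; have [_ le2 gt2] := bP i2.
rewrite -b12 in le2 gt2.
have j12 : j i1 <= j i2 by rewrite leq_trunc_log // leq_exp2l // ltnW.
(* Two numbers in the same piece [[B/n, (B+1)/n[] have a quotient strictly between [B/(B+1)] and
   [(B+1)/B], and [B >= n]. *)
exists (i2 - i1), (j i2 - j i1); rewrite subn_gt0.
have pD : p ^ i2 = p ^ i1 * p ^ (i2 - i1) by rewrite -expnD subnKC // ltnW.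
have qD : q ^ j i2 = q ^ j i1 * q ^ (j i2 - j i1) by rewrite -expnD subnKC.
rewrite pD qD in le2 gt2 => {pD qD}.
have P0 : 0 < p ^ i1 by rewrite expn_gt0 p0.
have Q0 : 0 < q ^ j i1 by rewrite expn_gt0 q0.
have a0 : 0 < p ^ (i2 - i1) by rewrite expn_gt0 p0.
have c0 : 0 < q ^ (j i2 - j i1) by rewrite expn_gt0 q0.
move: (b i1) (p ^ i1) (q ^ j i1) (p ^ _) (q ^ _) P0 Q0 a0 c0 nb1 le1 gt1 le2 gt2.
move=> B P Q a c P0 Q0 a0 c0 nB le1 gt1 le2 gt2; split=> //.
- apply: (ltn_mulS_mono _ B) => //; rewrite -(ltn_pmul2l Q0) mulnCA.
  apply: leq_ltn_trans le2 _.
  by rewrite mulnA [X in _ < X]mulnCA [X in _ < X]mulnA ltn_pmul2r.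
- apply: (ltn_mulS_mono _ B) => //; rewrite -(ltn_pmul2l Q0) [X in _ < X]mulnCA.
  apply: leq_ltn_trans gt2.
  by rewrite mulnA [X in _ <= X]mulnA leq_mul // mulnC.
Qed.

(** Steps by a ratio [r = p^a / q^c] within a factor [1 + 1/n] of [1] cannot jump over a window of
    that relative width, so a first crossing lands in it. *)
Lemma prime_ratio_dense A n p q :
  prime p -> prime q -> p != q -> 0 < n -> 0 < A ->
  exists i j, q ^ j <= A * p ^ i /\ n * (A * p ^ i) < n.+1 * q ^ j.
Proof.
move=> pp pq npq n0 A0.
have [p0 q0] := (prime_gt0 pp, prime_gt0 pq).
have [p1 q1] := (prime_gt1 pp, prime_gt1 pq).
have [a [c [a0 lt1 lt2]]] := prime_powers_close n p q pp pq npq n0.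
have pa0 : 0 < p ^ a by rewrite expn_gt0 p0.
have qc0 : 0 < q ^ c by rewrite expn_gt0 q0.
have [ltpq|ltqp|eqpq] := ltngtP (p ^ a) (q ^ c); last first.
- by have := dvdn_exp a0 (dvdnn p); rewrite eqpq Euclid_dvdX // dvdn_prime2 // (negPf npq).
(* For [r > 1] the target is [q^A]: it exceeds [A], so the crossing takes at least one step. *)
- have exP : exists N, q ^ A * (q ^ c) ^ N <= A * (p ^ a) ^ N.
    have [N ltN] := ltn_exp_dominate (q ^ A) _ _ qc0 ltqp.
    by exists N; nia.
  case: (ex_minnP exP) => -[|N] leN minN.
    by move: leN; rewrite !expn0 !muln1 leqNgt ltn_expl.
  exists (a * N.+1), (A + c * N.+1); rewrite expnD !expnM; split=> //.
  have ltN : A * (p ^ a) ^ N < q ^ A * (q ^ c) ^ N.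
    by rewrite ltnNge; apply/negP => /minN; rewrite ltnn.
  rewrite !expnS; nia.
(* For [r < 1] the wanted exponent is the last one before [A * r^N] drops below [1]. *)
- have exP : exists N, A * (p ^ a) ^ N < (q ^ c) ^ N := ltn_exp_dominate A _ _ pa0 ltpq.
  case: (ex_minnP exP) => -[|N] ltN minN.
    by move: ltN; rewrite !expn0 muln1 ltnNge A0.
  have leN : (q ^ c) ^ N <= A * (p ^ a) ^ N.
    by rewrite leqNgt; apply/negP => /minN; rewrite ltnn.
  exists (a * N), (c * N); rewrite !expnM; split=> //.
  move: ltN; rewrite !expnS; nia.
Qed.

(** * Base-s expansions *)

(* The expansion of the fractional part of [x / y]; all [0] when [y = 0]. *)
Definition digits {s} (s0 : 0 < s) (x y : nat) : seqspace s :=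
  fun k => Ordinal (ltn_pmod (x * s ^ k.+1 %/ y) s0).

Lemma shift_digits s (s0 : 0 < s) x y :
  Defs.shift (digits s0 x y) = digits s0 (s * x) y.
Proof.
by apply: funext => k; apply: val_inj => /=; rewrite (expnS s k.+1) mulnA (mulnC x).
Qed.

Lemma digitsM s (s0 : 0 < s) c x y : 0 < c ->
  digits s0 (c * x) (c * y) = digits s0 x y.
Proof.
by move=> c0; apply: funext => k; apply: val_inj; rewrite /= -mulnA divnMl.
Qed.

Lemma iter_shift_digits s (s0 : 0 < s) x L k :
  iter k (@Defs.shift s) (digits s0 x (s ^ (L + k))) = digits s0 x (s ^ L).
Proof.
elim: k => [|k IHk] /=; first by rewrite addn0.
rewrite -iterS iterSr shift_digits addnS expnS digitsM //.
Qed.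

Lemma mu_digits s (s0 : 0 < s) p x y : p %| s -> 0 < y ->
  mu_ s p (digits s0 x y) = digits s0 (p * x) y.
Proof.
move=> ps y0; have p0 := dvdn_gt0 s0 ps.
apply: funext => k; apply: val_inj => /=.
rewrite (expnS s k.+1); move: (s ^ k.+1) => S.
have w0 : 0 < s %/ p by rewrite divn_gt0 // dvdn_leq.
have spw : s = p * (s %/ p) by rewrite mulnC divnK.
have -> : p * (x * (s * S) %/ y %% s) %/ s = (p * x * S %/ y) %% p.
  rewrite {3}spw divnMl // {2}spw mulnC -modn_divl; congr (_ %% _).
  by rewrite -divnMA {1}spw (_ : _ * _ = p * x * S * (s %/ p)) ?divnMr //; lia.
rewrite -modnDml modnMmr modnDml; congr (_ %% _).
rewrite [RHS](divn_eq _ p); congr (_ + _).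
by rewrite mulnC -divnMA -mulnA (mulnC y) divnMl.
Qed.

Lemma mu_zero_digits s (s0 : 0 < s) (a : seqspace s) : mu_zero s a = digits s0 0 1.
Proof. by apply: funext => k; apply: val_inj; rewrite /= divn1 mul0n mod0n. Qed.

Lemma digits0 s (s0 : 0 < s) y : digits s0 0 y = digits s0 0 1.
Proof. by apply: funext => k; apply: val_inj; rewrite /= !mul0n !div0n. Qed.

(** Most significant symbol first, so that cylinders of length [n] correspond to integers below
    [s^n]. *)
Fixpoint prefix {s} (n : nat) (a : seqspace s) : nat :=
  if n is m.+1 then s * prefix m a + (a m : 'I_s) else 0.

Lemma prefix_lt s (s0 : 0 < s) n (a : seqspace s) : prefix n a < s ^ n.
Proof.
elim: n => [|n IHn] //=; rewrite expnS.
have := ltn_ord (a n : 'I_s); nia.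
Qed.

Lemma prefix_shift s n (a : seqspace s) :
  prefix n.+1 a = (a 0 : 'I_s) * s ^ n + prefix n (Defs.shift a).
Proof.
elim: n => [|n IHn]; first by rewrite /= muln0 muln1 addn0.
rewrite [LHS]/= -/(prefix n.+1 a) IHn /= expnS /Defs.shift; lia.
Qed.

Lemma cylinder_prefix s (a b : seqspace s) n :
  cylinder a n b <-> prefix n b = prefix n a.
Proof.
split; elim: n => [|n IHn] //=.
  by move=> ab; rewrite ab // IHn // => i /ltnW; apply: ab.
move=> eqab i; rewrite ltnS leq_eqVlt => lein.
have la := ltn_ord (a n : 'I_s); have lb := ltn_ord (b n : 'I_s).
have [eqn eqp] : nat_of_ord (b n) = nat_of_ord (a n) /\ prefix n b = prefix n a.
  suff : prefix n b = prefix n a by nia.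
  move: eqab => /(congr1 (divn^~ s)); rewrite !(mulnC s) !divnMDl ?divn_small ?addn0 //; lia.
by case/orP: lein => [/eqP->|]; [apply: val_inj|apply: IHn].
Qed.

Lemma prefix_digits s (s0 : 0 < s) n x y :
  prefix n (digits s0 x y) = (x * s ^ n %/ y) %% s ^ n.
Proof.
elim: n => [|n IHn] /=; first by rewrite modn1.
rewrite IHn; set Z := x * s ^ n.+1 %/ y.
have -> : x * s ^ n %/ y = Z %/ s.
  by rewrite /Z -divnMA expnS mulnCA (mulnC y) divnMl.
by rewrite modn_divl -expnSr [RHS](divn_eq _ s) mulnC modn_dvdm // expnS dvdn_mulr.
Qed.

Lemma digits_prefix_cylinder s (s0 : 0 < s) n (a : seqspace s) :
  cylinder a n (digits s0 (prefix n a) (s ^ n)).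
Proof.
by apply/cylinder_prefix; rewrite prefix_digits mulnK ?expn_gt0 ?s0 // modn_small ?prefix_lt.
Qed.

Lemma digits_expn_inj s (s0 : 0 < s) (s1 : 1 < s) x x' :
  (forall L, digits s0 x (s ^ L) = digits s0 x' (s ^ L)) -> x = x'.
Proof.
(* With [L = x + x'], [s^L] exceeds both numerators, so the first [L] symbols recover them. *)
move=> /(_ (x + x')) /(congr1 (prefix (x + x'))).
rewrite !prefix_digits !mulnK ?expn_gt0 ?s0 //.
have := ltn_expl (x + x') s1.
by move=> lt; rewrite !modn_small //; apply: leq_ltn_trans lt; lia.
Qed.

Lemma eq_continuous_digits s (s0 : 0 < s) (f g : seqspace s -> seqspace s) :
  continuous f -> continuous g ->
  (forall x L, f (digits s0 x (s ^ L)) = g (digits s0 x (s ^ L))) -> f = g.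
Proof.
move=> /continuous_seqspaceP cf /continuous_seqspaceP cg fg.
apply: funext => a; apply: funext => k.
have [n nP] := cf a k.+1; have [m mP] := cg a k.+1.
have := digits_prefix_cylinder _ s0 (n + m) a; set b := digits _ _ _ => ab.
rewrite -(nP b) -?(mP b) ?fg // => i lti; apply: ab; lia.
Qed.

(** * Maps commuting with multiplications *)

Lemma iter_shiftE s (a : seqspace s) n k : iter n (@Defs.shift s) a k = a (n + k).
Proof. by elim: n k => [|n IHn] k //=; rewrite /Defs.shift IHn addnS addSn. Qed.

Lemma digits_iter_shift0 s (s0 : 0 < s) L (b : seqspace s) :
  iter L (@Defs.shift s) b = digits s0 0 1 -> b = digits s0 (prefix L b) (s ^ L).
Proof.
move=> b0; apply: funext => k; have [kL|Lk] := ltnP k L.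
  by rewrite (digits_prefix_cylinder _ s0 L b).
have /(congr1 (fun c => c (k - L))) := b0; rewrite iter_shiftE subnKC // => ->.
apply: val_inj; rewrite /= mul0n div0n mod0n -(subnKC Lk) -addnS expnD.
by rewrite mulnCA mulKn ?expn_gt0 ?s0 // expnS mulnCA modnMr.
Qed.

Lemma cat_shift s tau (a : seqspace s) : CAT s tau ->
  tau (Defs.shift a) = Defs.shift (tau a).
Proof. by move=> [_ /(congr1 (fun f => f a))]. Qed.

Lemma cat_iter_shift s tau (a : seqspace s) n : CAT s tau ->
  tau (iter n (@Defs.shift s) a) = iter n (@Defs.shift s) (tau a).
Proof.
by move=> ctau; elim: n => [|n IHn] //=; rewrite -IHn cat_shift.
Qed.

(** Commuting with the shift and fixing [0], [tau] preserves eventually zero sequences. By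
    continuity at [0], [r] leading zeros force a leading zero in the image, so the numerator of the
    image stabilizes once [x] is preceded by [r] zeros. *)
Lemma cat_lift s (s0 : 0 < s) (s1 : 1 < s) tau :
  CAT s tau -> tau (digits s0 0 1) = digits s0 0 1 ->
  exists T C, (forall x L, tau (digits s0 x (s ^ L)) = digits s0 (T x) (s ^ L)) /\
    (forall x N, x < s ^ N -> T x < s ^ (N + C)).
Proof.
move=> ctau tau0; have [/continuous_seqspaceP ct _] := ctau.
have [r rP] := ct (digits s0 0 1) 1.
pose V x L := prefix L (tau (digits s0 x (s ^ L))).
have tauV x L : tau (digits s0 x (s ^ L)) = digits s0 (V x L) (s ^ L).
  apply: digits_iter_shift0; rewrite -cat_iter_shift // -[L in s ^ L]add0n.
  by rewrite iter_shift_digits -[RHS]tau0; congr tau; apply: funext => k;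
    apply: val_inj; rewrite /= expn0 !divn1 mul0n mod0n expnS mulnCA modnMr.
(* Here [x / s^L.+1] starts with [r] zeros, so its image starts with [0]; shifting that symbol away
   gives the image of [x / s^L]. *)
have VS x N L : x < s ^ N -> N + r <= L -> V x L.+1 = V x L.
  move=> xN NL; rewrite /V prefix_shift.
  have -> : tau (digits s0 x (s ^ L.+1)) 0 = digits s0 0 1 0.
    rewrite rP ?tau0 // => k kr; apply: val_inj.
    rewrite /= mul0n div0n mod0n divn_small ?mod0n //.
    apply: (@leq_trans (s ^ N * s ^ k.+1)); first by rewrite ltn_pmul2r ?expn_gt0 ?s0.
    rewrite -expnD leq_pexp2l //; lia.
  rewrite /= mul0n div0n mod0n mul0n add0n; congr prefix.
  by rewrite -cat_shift // shift_digits expnS digitsM.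
have VE x N L : x < s ^ N -> N + r <= L -> V x L = V x (N + r).
  move=> xN; elim: L => [|L IHL]; first by rewrite leqn0 => /eqP->.
  by rewrite leq_eqVlt => /orP[/eqP->//|NL]; rewrite (VS x N) ?IHL.
pose T x := V x (x + r).
have TE x N L : x < s ^ N -> N + r <= L -> T x = V x L.
  move=> xN NL; rewrite /T (VE x N L xN NL) -(VE x N (N + x + r) xN); last by lia.
  by rewrite (VE x x (N + x + r) (ltn_expl x s1)) //; lia.
exists T, r; split=> [x L|x N xN].
  (* Any [L] is reached by shifting from [L + (x + r)], which lies in the stable range because
     [x < s^x]. *)
  rewrite -(iter_shift_digits _ _ _ _ (x + r)) cat_iter_shift // tauV.
  have xL : x + r <= L + (x + r) by lia.
  by rewrite iter_shift_digits -(TE x x _ (ltn_expl x s1) xL).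
by rewrite (TE x N (N + r) xN (leqnn _)) prefix_lt.
Qed.

(** A single [L] gives the identity only modulo [s^L], since [digits] forgets the integer part; all
    [L] together give it on naturals. *)
Lemma cat_lift_mul s (s0 : 0 < s) (s1 : 1 < s) tau T n mu :
  (forall x L, tau (digits s0 x (s ^ L)) = digits s0 (T x) (s ^ L)) ->
  (forall x L, mu (digits s0 x (s ^ L)) = digits s0 (n * x) (s ^ L)) ->
  tau \o mu = mu \o tau -> forall x, T (n * x) = n * T x.
Proof.
move=> tauT mun comm x; apply: (digits_expn_inj _ s0 s1) => L.
by rewrite -tauT -!mun -tauT -[LHS]/((tau \o mu) _) comm.
Qed.

Lemma commute_expn_mul T n k : (forall x, T (n * x) = n * T x) ->
  forall x, T (n ^ k * x) = n ^ k * T x.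
Proof.
by move=> Tn; elim: k => [|k IHk] x; rewrite ?expn0 ?mul1n // expnS -!mulnA Tn IHk.
Qed.

(** The point [(s^(M+j) + B) / s^(L+M+j)] shares at least [n] symbols with [1 / s^L]; continuity
    there makes the first [L + m] symbols of the images agree. *)
Lemma cat_lift_close s (s0 : 0 < s) (s1 : 1 < s) tau T C m : CAT s tau ->
  (forall x L, tau (digits s0 x (s ^ L)) = digits s0 (T x) (s ^ L)) ->
  (forall x N, x < s ^ N -> T x < s ^ (N + C)) ->
  exists M, m <= M /\ forall j B, B < s ^ j ->
    T 1 * s ^ (M + j) <= T (s ^ (M + j) + B) < T 1 * s ^ (M + j) + s ^ (M + j - m).
Proof.
move=> [/continuous_seqspaceP ct _] tauT TC.
(* This [L] keeps both image numerators below their denominators, so no integer part is lost. *)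
pose L := C.+1.
have [n nP] := ct (digits s0 1 (s ^ L)) (L + m).
exists (n + m); split; first by lia.
move=> j B Bj; set M := n + m; set K := M + j.
have sX k : 0 < s ^ k by rewrite expn_gt0 s0.
have /nP/cylinder_prefix : cylinder (digits s0 1 (s ^ L)) n
    (digits s0 (s ^ K + B) (s ^ (L + K))).
  move=> k kn; apply: val_inj => /=; congr (_ %% _).
  pose e := K - k.+1; have Ke : K = k.+1 + e by rewrite /e; lia.
  have Be : B < s ^ e by apply: leq_trans Bj _; rewrite leq_pexp2l //; lia.
  rewrite mul1n (_ : L + K = e + L + k.+1); last by lia.
  rewrite [s ^ (_ + k.+1)]expnD divnMr // expnD divnMA; congr (_ %/ _).
  by rewrite Ke expnD divnMDl // divn_small ?addn0.
rewrite !tauT !prefix_digits.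
have -> : T 1 * s ^ (L + m) %/ s ^ L = T 1 * s ^ m.
  by rewrite expnD mulnCA mulKn.
have T1 : T 1 < s ^ L.
  by have := TC 1 1; rewrite expn1 add1n; apply.
have TK : T (s ^ K + B) < s ^ (L + K).
  rewrite (_ : L + K = K.+1 + C); last by lia.
  apply: TC; rewrite expnS.
  have : s ^ j <= s ^ K by rewrite leq_pexp2l // leq_addl.
  have := leq_mul s1 (leqnn (s ^ K)); move: (s ^ K) (s ^ j) Bj => S sj; lia.
have -> : T (s ^ K + B) * s ^ (L + m) %/ s ^ (L + K) = T (s ^ K + B) %/ s ^ (K - m).
  rewrite (_ : L + K = K - m + (L + m)); last by lia.
  by rewrite [s ^ (_ + (_ + _))]expnD divnMr.
rewrite !modn_small; last 2 first.
- by rewrite expnD ltn_pmul2r.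
- by rewrite ltn_divLR // -expnD (_ : L + m + (K - m) = L + K) //; lia.
move=> eqT.
have -> : s ^ K = s ^ m * s ^ (K - m) by rewrite -expnD subnKC //; lia.
rewrite [T 1 * _]mulnA -eqT.
by rewrite -[s ^ m * s ^ (K - m)]expnD subnKC ?leq_divM -?mulSnr ?ltn_ceil //; lia.
Qed.

(* With [s = q * w], take [x = s^M p^i w^j A], i.e. [s^(M+j)] times the ratio
   [A p^i / q^j], which is slightly above [1]: [T x] is both
   [s^M p^i w^j T A] and close to [s^(M+j) T 1]. *)
Lemma lift_linear s p q T : 1 < s -> prime p -> prime q -> p != q -> q %| s ->
  (forall x, T (s * x) = s * T x) ->
  (forall x, T (p * x) = p * T x) -> (forall x, T (q * x) = q * T x) ->
  (forall m, exists M, m <= M /\ forall j B, B < s ^ j ->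
    T 1 * s ^ (M + j) <= T (s ^ (M + j) + B) < T 1 * s ^ (M + j) + s ^ (M + j - m)) ->
  forall A, T A = T 1 * A.
Proof.
move=> s1 pp pq npq qs Ts Tp Tq close A.
have s0 : 0 < s by apply: ltnW.
have sX k : 0 < s ^ k by rewrite expn_gt0 s0.
have [->|A0] := posnP A.
  rewrite muln0; have := Tp 0; rewrite muln0.
  by have := prime_gt1 pp; nia.
pose w := s %/ q.
have sqw : s = q * w by rewrite mulnC divnK.
have Tw x : T (w * x) = w * T x.
  have := Tq (w * x); rewrite mulnA -sqw Ts {1}sqw -mulnA => /eqP.
  by rewrite eqn_pmul2l ?prime_gt0 // => /eqP.
(* At this precision [s^(A + T A)] exceeds both [A] and [T A], the errors left in the two final
   inequalities. *)
have [M [mM MP]] := close (A + T A).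
have [i [j [le1 lt1]]] := prime_ratio_dense A (s ^ M) p q pp pq npq (sX M) A0.
have qj0 : 0 < q ^ j by rewrite expn_gt0 prime_gt0.
have w0 : 0 < w ^ j by rewrite expn_gt0; move: s0; rewrite sqw muln_gt0 => /andP[_ ->].
pose beta := s ^ M * (p ^ i * w ^ j).
have Tb : T (beta * A) = beta * T A.
  by rewrite /beta -!mulnA !(commute_expn_mul T).
have sj : s ^ j = q ^ j * w ^ j by rewrite sqw expnMn.
have SD : s ^ (M + j) = s ^ M * s ^ j by rewrite expnD.
have le2 : s ^ (M + j) <= beta * A.
  have -> : beta * A = s ^ M * (A * p ^ i * w ^ j) by rewrite /beta; lia.
  by rewrite SD sj leq_mul // leq_mul.
have lt2 : beta * A < s ^ (M + j) + s ^ j.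
  have -> : beta * A = s ^ M * (A * p ^ i) * w ^ j by rewrite /beta; lia.
  by rewrite SD -mulSnr sj [X in _ < X]mulnA ltn_pmul2r.
have := MP j (beta * A - s ^ (M + j)); rewrite ltn_subLR // => /(_ lt2).
rewrite subnKC // Tb => /andP[le3 lt3].
have E : s ^ (M + j - (A + T A)) * s ^ (A + T A) = s ^ (M + j).
  by rewrite -expnD subnK //; lia.
have sm : A + T A < s ^ (A + T A) by rewrite ltn_expl.
have sjle : s ^ j <= s ^ (M + j - (A + T A)) by rewrite leq_pexp2l //; lia.
have c0 := sX (M + j - (A + T A)).
clear Tb sj SD MP lt1; clearbody beta.
move: E sm sjle lt3 le3 lt2 le2 c0.
move: (s ^ (M + j)) (s ^ (A + T A)) (s ^ j) (s ^ (M + j - (A + T A))).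
move: (T A) (T 1) => TA T1.
move=> S m sj c E sm sjc lt3 le3 lt2 le2 c0.
(* Both bounds estimate [beta * A * TA] twice: from [beta * A], close to [S], and from [beta * TA],
   close to [T1 * S]. *)
subst S; apply/eqP; rewrite eqn_leq; apply/andP; split.
- have : TA * (c * m) <= A * (T1 * (c * m) + c).
    apply: (@leq_trans (TA * (beta * A))); first by rewrite leq_mul.
    by rewrite mulnCA mulnA mulnC leq_mul // ltnW.
  rewrite (_ : TA * _ = c * (m * TA)); last by lia.
  rewrite (_ : A * _ = c * (m * (T1 * A) + A)); last by lia.
  by rewrite leq_pmul2l //; nia.
- have : T1 * (c * m) * A <= (c * m + c) * TA.
    apply: (@leq_trans (beta * TA * A)); first by rewrite leq_mul.
    by rewrite mulnAC leq_mul // ltnW //; apply: leq_trans lt2 _; rewrite leq_add2l.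
  rewrite (_ : T1 * _ * A = c * (m * (T1 * A))); last by lia.
  rewrite (_ : _ * TA = c * (m * TA + TA)); last by lia.
  by rewrite leq_pmul2l //; nia.
Qed.

(* With [c = s^L %/ l], the points [c / s^L] and [c.+1 / s^L] surround [1 / l]
   and agree with it to many digits, but multiplication by [n] sends them to
   opposite sides of the integer [n / l]. *)
Lemma cat_multiplier_smooth s (s0 : 0 < s) (s1 : 1 < s) tau n l : CAT s tau ->
  (forall x L, tau (digits s0 x (s ^ L)) = digits s0 (n * x) (s ^ L)) ->
  0 < n -> prime l -> l %| n -> l %| s.
Proof.
move=> [/continuous_seqspaceP ct _] taun n0 lp ln; apply: contraT => lNs.
have l0 := prime_gt0 lp.
have [N NP] := ct (digits s0 1 l) 1.
(* Large enough for [l - r < s^(L - N)] and [n * s <= s^L]. *)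
pose L := N + l * n + 1; pose c := s ^ L %/ l; pose r := s ^ L %% l.
have sX k : 0 < s ^ k by rewrite expn_gt0 s0.
have sL : s ^ L = c * l + r by rewrite /c /r -divn_eq.
have rl : r < l by rewrite ltn_mod.
have r0 : 0 < r.
  rewrite lt0n; apply: contra lNs => /eqP r0.
  by move: (Euclid_dvdX s L lp); rewrite /dvdn -/r r0 eqxx => /esym/andP[].
have cylc : cylinder (digits s0 1 l) N (digits s0 c (s ^ L)).
  apply/cylinder_prefix; rewrite !prefix_digits mul1n; congr (_ %% _).
  rewrite (_ : L = L - N + N); last by rewrite /L; lia.
  rewrite expnD divnMr // /c -divnMA (_ : s ^ L = s ^ N * s ^ (L - N)).
    by rewrite divnMr.
  by rewrite -expnD subnKC // /L; lia.
have cylc1 : cylinder (digits s0 1 l) N (digits s0 c.+1 (s ^ L)).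
  apply/cylinder_prefix; move/cylinder_prefix: cylc => <-.
  rewrite !prefix_digits; congr (_ %% _).
  rewrite (_ : L = L - N + N); last by rewrite /L; lia.
  rewrite expnD !divnMr // divnS //.
  suff /negPf-> : ~~ (s ^ (L - N) %| c.+1) by [].
  (* Otherwise [s^(L - N)] would divide [l * c.+1 - s^L = l - r], which is positive and smaller. *)
  apply/negP => dc.
  have : s ^ (L - N) %| l - r.
    rewrite -(@dvdn_addr (s ^ L)) ?dvdn_exp2l ?leq_subr //.
    by rewrite (_ : _ + _ = l * c.+1) ?dvdn_mull //; lia.
  have : l - r < s ^ (L - N).
    by apply: leq_ltn_trans (ltn_expl _ s1); rewrite /L; nia.
  by move=> ?; rewrite gtnNdvd // subn_gt0.
have /(_ 0 isT)/(congr1 val) := NP _ cylc; rewrite taun.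
have /(_ 0 isT)/(congr1 val) := NP _ cylc1; rewrite taun => <- /=.
(* With [n = m * l] the two first symbols are [m * s] and [m * s - 1] modulo [s], that is [0] and
   [s - 1], yet continuity makes them equal. *)
rewrite expn1; have [m nE] := dvdnP ln.
have m0 : 0 < m by move: n0; rewrite nE; case: (m).
have small : n * s <= s ^ L.
  rewrite /L addn1 expnSr leq_pmul2r // ltnW // (leq_trans (ltn_expl n s1)) //.
  by rewrite leq_pexp2l //; nia.
have -> : n * c.+1 * s %/ s ^ L = m * s.
  rewrite (_ : n * c.+1 * s = m * s * s ^ L + m * (l - r) * s); last first.
    by rewrite sL nE -(subnKC (ltnW rl)); move: (l - r) => k; lia.
  rewrite divnMDl // divn_small ?addn0 //; apply: leq_trans small.
  by rewrite ltn_pmul2r // nE; nia.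
have -> : n * c * s %/ s ^ L = m * s - 1.
  have E : n * c * s = (m * s - 1) * s ^ L + (s ^ L - m * r * s).
    have mrs : m * r * s <= s ^ L.
      by apply: leq_trans small; rewrite leq_pmul2r // nE leq_mul // ltnW.
    have ms : s ^ L <= m * s * s ^ L by rewrite leq_pmull // muln_gt0 m0.
    have : n * c * s + m * r * s = m * s * s ^ L by rewrite sL nE; lia.
    by rewrite mulnBl mul1n; lia.
  rewrite E divnMDl // divn_small ?addn0 // ltn_subrL sX andbT; nia.
rewrite modnMl.
rewrite (_ : m * s - 1 = m.-1 * s + s.-1); last by nia.
rewrite modnMDl modn_small; lia.
Qed.

(** * The generated semigroup *)

Lemma mu_cat s p : CAT s (mu_ s p).
Proof.
split; last by [].
apply/continuous_seqspaceP => a m; exists m.+1 => b ab k km.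
by apply: val_inj; rewrite /= !ab // ltnS ?(ltnW km) // ltnW.
Qed.

Lemma mu_one_cat s : CAT s (mu_one s).
Proof. by split=> //; apply/continuous_seqspaceP => a m; exists m. Qed.

Lemma mu_zero_cat s : CAT s (mu_zero s).
Proof.
split; last by apply: funext => a; apply: funext => k; apply: val_inj.
by apply/continuous_seqspaceP => a m; exists m => b _ k _; apply: val_inj.
Qed.

Lemma cat_comp s : comp_closed (CAT s).
Proof.
move=> f g [cf fs] [cg gs]; split.
  by move=> a; apply: continuous_comp; [exact: cg|exact: cf].
by apply: funext => a; rewrite -compA gs compA fs.
Qed.

Lemma generated_comp s G : comp_closed (@generated s G).
Proof. by move=> f g fG gG A AP; apply: (AP.1); [exact: fG|exact: gG]. Qed.

Lemma sub_generated s G : G `<=` @generated s G.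
Proof. by move=> f Gf A [_]; apply. Qed.

Lemma generated_sub s G A : @comp_closed s A -> G `<=` A -> generated G `<=` A.
Proof. by move=> cA GA f; apply. Qed.

Definition commutant s (f : seqspace s -> seqspace s) :
    set (seqspace s -> seqspace s) :=
  [set g | f \o g = g \o f].

Lemma commutant_comp s f : comp_closed (commutant s f).
Proof. by move=> g h fg fh; rewrite /commutant/= compA fg -[LHS]compA fh. Qed.

Definition multiplier {s} (s0 : 0 < s) n : set (seqspace s -> seqspace s) :=
  [set f | forall x y, 0 < y -> f (digits s0 x y) = digits s0 (n * x) y].

Lemma mu_zero_multiplier s (s0 : 0 < s) : multiplier s0 0 (mu_zero s).
Proof. by move=> x y _; rewrite (mu_zero_digits _ s0) mul0n [RHS]digits0. Qed.

Lemma mu_one_multiplier s (s0 : 0 < s) : multiplier s0 1 (mu_one s).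
Proof. by move=> x y _; rewrite mul1n. Qed.

Lemma mu_multiplier s (s0 : 0 < s) p : p %| s -> multiplier s0 p (mu_ s p).
Proof. by move=> ps x y; apply: mu_digits. Qed.

Lemma comp_multiplier s (s0 : 0 < s) n m f g :
  multiplier s0 n f -> multiplier s0 m g -> multiplier s0 (n * m) (f \o g).
Proof. by move=> fn gm x y y0; rewrite /= gm // fn // mulnA. Qed.

Lemma cat_multiplier_inj s (s0 : 0 < s) n f g :
  CAT s f -> CAT s g -> multiplier s0 n f -> multiplier s0 n g -> f = g.
Proof.
move=> [cf _] [cg _] fn gn; apply: (eq_continuous_digits _ s0) => // x L.
by rewrite fn ?gn // expn_gt0 s0.
Qed.

Section Generators.
Variables (s : nat) (s0 : 0 < s) (I : Type) (p : I -> nat).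
Hypothesis ps : forall i, p i %| s.

Let gens := range (fun i => mu_ s (p i)) `|` [set mu_zero s; mu_one s].

Lemma gens_cat_multiplier f :
  generated gens f -> CAT s f /\ exists n, multiplier s0 n f.
Proof.
apply: (generated_sub _ _ [set f | CAT s f /\ exists n, multiplier s0 n f]).
  move=> g h [cg [n gn]] [ch [m hm]]; split; first exact: cat_comp.
  by exists (n * m); apply: comp_multiplier.
move=> g [[i _ <-]|[->|->]]; split; [exact: mu_cat| |exact: mu_zero_cat| |exact: mu_one_cat|].
- by exists (p i); apply: mu_multiplier.
- by exists 0; apply: mu_zero_multiplier.
- by exists 1; apply: mu_one_multiplier.
Qed.

Lemma gens_comm f g : generated gens f -> generated gens g -> f \o g = g \o f.
Proof.
move=> /gens_cat_multiplier[cf [n fn]] /gens_cat_multiplier[cg [m gm]].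
apply: (cat_multiplier_inj _ s0 (n * m)); try exact: cat_comp.
  exact: comp_multiplier.
by rewrite mulnC; apply: comp_multiplier.
Qed.

Lemma gens_smooth n : 0 < n ->
  (forall l, prime l -> l %| n -> exists i, l = p i) ->
  exists2 f, generated gens f & multiplier s0 n f.
Proof.
elim/ltn_ind: n => n IHn n0 nP; have [n1|n1] := leqP n 1.
  have -> : n = 1 by lia.
  by exists (mu_one s); [apply: sub_generated; right; right|exact: mu_one_multiplier].
have lp := pdiv_prime n1; have [i li] := nP _ lp (pdiv_dvd n).
have nE : n = p i * (n %/ p i) by rewrite mulnC divnK // -li pdiv_dvd.
have p1 : 1 < p i by rewrite -li prime_gt1.
have [|||f fG fn] := IHn (n %/ p i).
- by rewrite ltn_Pdiv.
- by rewrite lt0n; apply/eqP => d0; rewrite nE d0 muln0 in n0.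
- by move=> l lpr ln; apply: nP => //; rewrite nE dvdn_mull.
exists (mu_ s (p i) \o f).
  by apply: generated_comp => //; apply: sub_generated; left; exists i.
by rewrite nE; apply: comp_multiplier => //; apply: mu_multiplier.
Qed.

Lemma gens_maximal_commutative (i j : I) :
  prime (p i) -> prime (p j) -> p i != p j ->
  (forall l, prime l -> l %| s -> exists i, l = p i) ->
  maximal_commutative (generated gens).
Proof.
move=> pi pj pij sP.
have s1 : 1 < s by apply: leq_trans (dvdn_leq s0 (ps i)); apply: prime_gt1.
split; [by move=> f /gens_cat_multiplier[]|exact: generated_comp|exact: gens_comm|].
move=> tau ctau commtau.
have commg f : gens f -> tau \o f = f \o tau by move=> /sub_generated; apply: commtau.
have tau0 : tau (digits s0 0 1) = digits s0 0 1.
  have /commg/(congr1 (fun f => f (digits s0 0 1))) : gens (mu_zero s) by right; left.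
  by rewrite /= !(mu_zero_digits _ s0).
have [T [C [tauT TC]]] := cat_lift _ s0 s1 _ ctau tau0.
have sX L : 0 < s ^ L by rewrite expn_gt0 s0.
have Tp k x : T (p k * x) = p k * T x.
  apply: (cat_lift_mul _ s0 s1 _ _ _ (mu_ s (p k)) tauT).
    by move=> y L; apply: mu_digits.
  by apply: commg; left; exists k.
(* The shift is multiplication by [s], and [tau] commutes with it as a member of [CAT]. *)
have Ts x : T (s * x) = s * T x.
  apply: (cat_lift_mul _ s0 s1 _ _ _ (@Defs.shift s) tauT) => [y L|].
    exact: shift_digits.
  by case: ctau.
have TE A : T A = T 1 * A.
  apply: (lift_linear s (p i) (p j)) => // m.
  exact: cat_lift_close tauT TC.
have taun x L : tau (digits s0 x (s ^ L)) = digits s0 (T 1 * x) (s ^ L).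
  by rewrite tauT TE.
suff [f fG fn] : exists2 f, generated gens f & multiplier s0 (T 1) f.
  have [[cf _] _] := gens_cat_multiplier _ fG.
  suff -> : tau = f by [].
  by case: ctau => ct _; apply: (eq_continuous_digits _ s0) => // x L; rewrite taun fn.
have [n0|n0] := posnP (T 1).
  rewrite n0; exists (mu_zero s); last exact: mu_zero_multiplier.
  by apply: sub_generated; right; left.
apply: gens_smooth => // l lp ln; apply: sP => //.
exact: cat_multiplier_smooth ctau taun n0 lp ln.
Qed.

End Generators.

(** * Prime powers *)

Lemma prefixS_div s (s0 : 0 < s) n (a : seqspace s) : prefix n.+1 a %/ s ^ n = a 0.
Proof.
by rewrite prefix_shift divnMDl ?expn_gt0 ?s0 // divn_small ?addn0 // prefix_lt.
Qed.

Definition top_symbol {s} (s0 : 0 < s) : seqspace s :=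
  fun=> Ordinal (ltn_pmod s.-1 s0).

(** The carry is [p - 1] at every place, and [p * (s - 1) + (p - 1) = p * s - 1] is [s - 1] modulo
    [s]. *)
Lemma mu_top s (s0 : 0 < s) p : p %| s -> mu_ s p (top_symbol s0) = top_symbol s0.
Proof.
move=> ps; have p0 := dvdn_gt0 s0 ps; have le_ps := dvdn_leq s0 ps.
apply: funext => k; apply: val_inj => /=; rewrite (@modn_small s.-1); last by lia.
have -> : p * s.-1 = p.-1 * s + (s - p) by nia.
rewrite divnMDl // divn_small ?addn0; last by lia.
rewrite (_ : _ + _ = p.-1 * s + s.-1); last by nia.
by rewrite modnMDl modn_small // prednK.
Qed.

Lemma iter_mu_local s p j (a b : seqspace s) k :
  cylinder a (k + j).+1 b -> iter j (mu_ s p) b k = iter j (mu_ s p) a k.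
Proof.
elim: j a b => [|j IHj] a b ab; first by apply: ab; rewrite addn0.
rewrite !iterSr; apply: IHj => i ik; apply: val_inj => /=.
by rewrite !ab //; lia.
Qed.

Section Itinerary.
Variables (s q e : nat) (q0 : 0 < q).
Hypothesis sqe : s = q ^ e.+1.

(* As [mu_ s q] is the shift on base-[q] digits, reading off one base-[q]
   symbol from each iterate and regrouping [e.+1] of them into a base-[s] symbol
   gives a map that commutes with [mu_ s q]. *)
Definition itinerary (a : seqspace s) k : seqspace q := fun j =>
  Ordinal (ltn_pmod (iter j (mu_ s q) a k != iter j (mu_ s q) a k.+1) q0).

(** Its base-[q] digits record whether adjacent symbols differ, so it kills every constant sequence
    fixed by [mu_ s q]. *)
Definition change_map (a : seqspace s) : seqspace s :=
  fun k => symb_mod (a k) (prefix e.+1 (itinerary a k)).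

Let s0 : 0 < s. Proof. by rewrite sqe expn_gt0 q0. Qed.
Let qs : q %| s. Proof. by rewrite sqe expnS dvdn_mulr. Qed.

Lemma iter_mu_shift : iter e.+1 (mu_ s q) = @Defs.shift s.
Proof.
apply: (cat_multiplier_inj _ s0 s).
- elim: e.+1 => [|n IHn]; first exact: mu_one_cat.
  exact: cat_comp (mu_cat _ _) IHn.
- split=> //; apply/continuous_seqspaceP => a m; exists m.+1 => b ab k km.
  exact: ab.
- rewrite [X in multiplier _ X]sqe; elim: e.+1 => [|n IHn]; first exact: mu_one_multiplier.
  by rewrite expnS; apply: comp_multiplier IHn; apply: mu_multiplier.
- by move=> x y _; apply: shift_digits.
Qed.

Lemma iter_mu_comm_shift j (a : seqspace s) k :
  iter j (mu_ s q) (Defs.shift a) k = iter j (mu_ s q) a k.+1.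
Proof. by rewrite -iter_mu_shift -iterD addnC iterD iter_mu_shift. Qed.

Lemma itinerary_shift a k : itinerary (Defs.shift a) k = itinerary a k.+1.
Proof. by apply: funext => j; apply: val_inj; rewrite /= !iter_mu_comm_shift. Qed.

Lemma itinerary_mu a k : itinerary (mu_ s q a) k = Defs.shift (itinerary a k).
Proof. by apply: funext => j; apply: val_inj; rewrite /= -!iterSr. Qed.

Lemma itinerary_eS a k : itinerary a k e.+1 = itinerary a k.+1 0.
Proof. by apply: val_inj; rewrite /itinerary iter_mu_shift. Qed.

Lemma change_map_val a k : change_map a k = prefix e.+1 (itinerary a k) :> nat.
Proof. by apply: modn_small; rewrite [X in _ < X]sqe prefix_lt. Qed.

(** The carry is the leading base-[q] digit of the next block, so [mu_ s q] forms the prefix of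
    length [e.+2] of the itinerary; its leading digit has weight [s] and vanishes modulo [s]. *)
Lemma change_map_mu a : change_map (mu_ s q a) = mu_ s q (change_map a).
Proof.
apply: funext => k; apply: ord_inj; rewrite change_map_val.
rewrite -[RHS]/((q * change_map a k + q * change_map a k.+1 %/ s) %% s) !change_map_val.
rewrite -[LHS](@modn_small _ s); last by rewrite [X in _ < X]sqe prefix_lt.
have -> : q * prefix e.+1 (itinerary a k.+1) %/ s = itinerary a k e.+1.
  by rewrite [X in _ %/ X]sqe expnS divnMl // prefixS_div // itinerary_eS.
rewrite itinerary_mu -[_ + _]/(prefix e.+2 (itinerary a k)) (prefix_shift _ e.+1) -sqe.
by rewrite modnMDl.
Qed.

Lemma change_map_cat : CAT s change_map.
Proof.
split.
  apply/continuous_seqspaceP => a m; exists (m + e).+2 => b ab k km.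
  apply: val_inj; rewrite /= -!/(prefix e.+1 (itinerary _ _)); congr (_ %% _).
  apply/cylinder_prefix => j je; apply: val_inj => /=.
  rewrite (iter_mu_local _ _ _ a b k) ?(iter_mu_local _ _ _ a b k.+1) // => i ij;
    by apply: ab; lia.
apply: funext => a; apply: funext => k; apply: val_inj.
by rewrite /= -!/(prefix e.+1 (itinerary _ _)) itinerary_shift.
Qed.

Lemma change_map_const a : mu_ s q a = a -> (forall k, a k.+1 = a k) ->
  change_map a = digits s0 0 1.
Proof.
move=> mua ac; apply: funext => k; apply: ord_inj; rewrite change_map_val.
have -> : itinerary a k = digits q0 0 1.
  apply: funext => j; apply: val_inj; rewrite /= (_ : iter j _ a = a).
    by rewrite ac eqxx mul0n.
  by elim: j => //= j ->.
by rewrite prefix_digits /= !mul0n !div0n !mod0n.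
Qed.

(** The expansion of [1 / s] begins with [1, 0]: the symbols differ, so the leading base-[q] digit
    of the image is [1]. *)
Lemma change_map_neq0 : 1 < q -> change_map (digits s0 1 s) 0 <> digits s0 0 1 0.
Proof.
move=> q1 /(congr1 (@nat_of_ord s)).
rewrite change_map_val [RHS]/= mul0n div0n mod0n => pre0.
have s1 : 1 < s by rewrite sqe -(expn0 q) ltn_exp2l.
have := prefixS_div _ q0 e (itinerary (digits s0 1 s) 0).
rewrite pre0 div0n /= -val_eqE /= !mul1n expn1 expnS divnn s0 mulKn //.
by rewrite expn1 modnn modn_small // modn_small.
Qed.

Lemma not_maximal_commutative I (p : I -> nat) : 1 < q -> (forall i, p i = q) ->
  ~ maximal_commutative
      (generated (range (fun i => mu_ s (p i)) `|` [set mu_zero s; mu_one s])).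
Proof.
move=> q1 pq [_ _ _ maxS].
set G := _ `|` _ in maxS.
have /maxS Gtau := change_map_cat.
have {}Gtau : generated G change_map.
  apply: Gtau => f; apply: (generated_sub _ _ (commutant _ change_map)).
    exact: commutant_comp.
  move=> g [[i _ <-]|[->|->]]; apply: funext => a //=.
    by rewrite pq change_map_mu.
  by rewrite !(mu_zero_digits _ s0) change_map_const // mu_digits // muln0.
pose z := digits s0 0 1; pose c := top_symbol s0.
(* This invariant excludes [change_map], which sends [c] to [z] without being the zero map. *)
have inv : generated G `<=` [set f | f z = z /\ (f c = c \/ f = mu_zero s)].
  apply: generated_sub.
    move=> f g [fz fc] [gz gc]; split; first by rewrite /= gz fz.
    case: gc => [gc|->]; last first.
      by right; apply: funext => a; rewrite /= !(mu_zero_digits _ s0) -/z fz.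
    case: fc => [fc|->]; first by left; rewrite /= gc fc.
    by right; apply: funext => a; rewrite /= !(mu_zero_digits _ s0).
  move=> g [[i _ <-]|[->|->]]; split=> //.
  - by rewrite pq /z mu_digits // muln0.
  - by left; rewrite pq mu_top.
  - exact: mu_zero_digits.
  - by right.
  - by left.
have [_ [|tau0]] := inv _ Gtau.
  rewrite change_map_const ?mu_top // => /(congr1 (fun a => val (a 0))) /=.
  rewrite mul0n div0n mod0n modn_small ?prednK // => s1.
  by have : 1 < s; [rewrite sqe -(expn0 q) ltn_exp2l|rewrite -(prednK s0) -s1].
by apply: (change_map_neq0 q1); rewrite tau0 (mu_zero_digits _ s0).
Qed.

End Itinerary.

Theorem theorem2p3 (s : nat) (hs : 2 <= s)
    (d : nat) (p e : 'I_d -> nat)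
    (hp : forall i, prime (p i)) (hinj : injective p)
    (he : forall i, 1 <= e i)
    (hdec : s = \prod_(i < d) p i ^ e i) :
  maximal_commutative
    (generated (range (fun i => mu_ s (p i)) `|` [set mu_zero s; mu_one s]))
  <-> ~ prime_power s.
Proof.
have s0 : 0 < s by apply: ltnW.
have ps i : p i %| s.
  by rewrite hdec (bigD1 i) //= dvdn_mulr // dvdn_exp.
have sP l : prime l -> l %| s -> exists i, l = p i.
  move=> lp; rewrite hdec Euclid_dvd_prod // big_orE => /existsP[i /=].
  by rewrite Euclid_dvdX // dvdn_prime2 // => /andP[/eqP-> _]; exists i.
split=> [maxS [q [k [qp k0 sqk]]]|npp].
  have sqk1 : s = q ^ k.-1.+1 by rewrite prednK.
  apply: (not_maximal_commutative s q k.-1 (prime_gt0 qp) sqk1 _ p) maxS.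
    exact: prime_gt1.
  by move=> i; have := ps i; rewrite sqk Euclid_dvdX // dvdn_prime2 // => /andP[/eqP].
have [i pdivi] := sP _ (pdiv_prime hs) (pdiv_dvd s).
(* If all the [p j] coincided, [s] would equal its own [p i]-part, a prime power. *)
have [j pij] : exists j, p i != p j.
  apply: contrapT => nex; apply: npp; exists (p i), (logn (p i) s); split=> //.
    by rewrite logn_gt0 mem_primes hp s0 ps.
  rewrite -p_part part_pnat_id //; apply/pnatP => // l lp ls.
  have [j lj] := sP _ lp ls; rewrite inE lj; apply: contrapT => pji.
  by apply: nex; exists j; rewrite eq_sym; apply/negP.
exact: (gens_maximal_commutative s s0 _ p ps i j).
Qed.
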